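(* Let $A$ and $B$ be two semiprime algebras of $\mathcal{V}$ such that $K(A)$ and $K(B)$ are closed under the commutator operation, and let $f:A\rightarrow B$ be an admissible morphism. The following properties are equivalent: (1) $f:A\rightarrow B$ is a $PP$-morphism; (2) $L(f):L(A)\rightarrow L(B)$ is a Stone morphism.
   Context: $\mathcal{V}$ is a fixed congruence-modular variety of algebras (of a finite signature) that is semidegenerate: no nontrivial algebra in $\mathcal{V}$ has one-element subalgebras (equivalently, $\nabla_A$ is compact in $Con(A)$ for every $A\in\mathcal{V}$). For $A\in\mathcal{V}$, $Con(A)$ is the complete lattice of congruences of $A$, with least element $\Delta_A$ and greatest element $\nabla_A$; $K(A)$ is the set of compact (= finitely generated) congruences. Commutator: $[\cdot,\cdot]=[\cdot,\cdot]_A$ is the (modular) commutator, i.e. the greatest operation on the congruence lattices of members of $\mathcal{V}$ such that for every surjective morphism $f:A\to B$ in $\mathcal{V}$ and all $\alpha,\beta\in Con(A)$: $[\alpha,\beta]_A\subseteq\alpha\cap\beta$ and $[\alpha,\beta]_A\vee Ker(f)=f^{-1}([f(\alpha\vee Ker(f)),f(\beta\vee Ker(f))]_B)$. Put $\alpha^{\perp_A}=\bigvee\{\gamma\in Con(A)\mid[\alpha,\gamma]_A=\Delta_A\}$. $\phi\in Con(A)\setminus\{\nabla_A\}$ is prime if $[\alpha,\beta]\subseteq\phi$ implies $\alpha\subseteq\phi$ or $\beta\subseteq\phi$ (for $\alpha,\beta\in Con(A)$); $Spec(A)$ is the set of prime congruences; $\rho(\theta)=\bigcap\{\phi\in Spec(A)\mid\theta\subseteq\phi\}$;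 $A$ is semiprime if $\rho(\Delta_A)=\Delta_A$. Reticulation: when $K(A)$ is closed under the commutator, $L(A)=K(A)/{\equiv}$ where $\alpha\equiv\beta$ iff $\rho(\alpha)=\rho(\beta)$; $\lambda_A:K(A)\to L(A)$ is the quotient map; $L(A)$ is a bounded distributive lattice with $\lambda_A(\alpha)\vee\lambda_A(\beta)=\lambda_A(\alpha\vee\beta)$, $\lambda_A(\alpha)\wedge\lambda_A(\beta)=\lambda_A([\alpha,\beta])$, $0=\lambda_A(\Delta_A)$, $1=\lambda_A(\nabla_A)$. Morphisms: a morphism $f:A\to B$ in $\mathcal{V}$ is admissible if $f^{-1}(\psi)=\{(a,a')\in A^2\mid(f(a),f(a'))\in\psi\}\in Spec(A)$ for every $\psi\in Spec(B)$. For $\alpha\in Con(A)$, $f^{\bullet}(\alpha)$ is the congruence of $B$ generated by $f(\alpha)=\{(f(a),f(a'))\mid(a,a')\in\alpha\}$; it maps $K(A)$ into $K(B)$. For admissible $f$, $L(f):L(A)\to L(B)$ is the (unique, well-defined) morphism of bounded distributive lattices with $L(f)(\lambda_A(\alpha))=\lambda_B(f^{\bullet}(\alpha))$ for all $\alpha\in K(A)$. $f$ is a $PP$-morphism if for all $\alpha,\beta\in K(A)$, $\alpha^{\perp_A}=\beta^{\perp_A}$ implies $(f^{\bullet}(\alpha))^{\perp_B}=(f^{\bullet}(\beta))^{\perp_B}$. A morphism $g:L\to L'$ of bounded distributive lattices is a Stone morphism if for all $a,b\in L$, $Ann(a)=Ann(b)$ implies $Ann(g(a))=Ann(g(b))$,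 where $Ann(x)=\{y\mid x\wedge y=0\}$. *)

(* Defs.v *)
From HB Require Import structures.
From mathcomp Require Import all_boot all_order.
From mathcomp Require Import generic_quotient.
From mathcomp Require Import boolp classical_sets cardinality.

Set Implicit Arguments.
Unset Strict Implicit.
Unset Printing Implicit Defensive.

Import Order.TTheory.

Local Open Scope classical_set_scope.
Local Open Scope quotient_scope.

Record signature := Signature {
  op_symb : finType;
  arity : op_symb -> nat }.

(* Algebras are nonempty, as usual in universal algebra. *)
Record algebra (S : signature) := Algebra {
  carrier :> Type;
  op : forall s : op_symb S, ('I_(arity s) -> carrier) -> carrier;
  carrier_inhabited : inhabited carrier }.

Inductive term (S : signature) : Type :=
| Var of nat
| App (s : op_symb S) of ('I_(arity s) -> term S).

Fixpoint eval (S : signature) (A : algebra S) (v : nat -> A) (t : term S) : A :=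
  match t with
  | Var n => v n
  | App s ts => op (fun i => eval v (ts i))
  end.

(* A variety is given by its defining identities (Birkhoff). *)
Definition variety (S : signature) := set (term S * term S).

Definition models (S : signature) (A : algebra S) (V : variety S) :=
  forall e, V e -> forall v : nat -> A, eval v e.1 = eval v e.2.

Record algebra_in (S : signature) (V : variety S) := AlgebraIn {
  alg_of :> algebra S;
  alg_models : models alg_of V }.

Record hom (S : signature) (A B : algebra S) := Hom {
  hom_fun :> A -> B;
  hom_op : forall (s : op_symb S) (x : 'I_(arity s) -> A),
    hom_fun (op x) = op (fun i => hom_fun (x i)) }.

Definition surjective_hom (S : signature) (A B : algebra S) (f : hom A B) :=
  forall b, exists a, f a = b.

Definition is_congruence (S : signature) (A : algebra S) (R : set (A * A)) :=
  [/\ forall x, R (x, x),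
      forall x y, R (x, y) -> R (y, x),
      forall y x z, R (x, y) -> R (y, z) -> R (x, z) &
      forall (s : op_symb S) (x y : 'I_(arity s) -> A),
        (forall i, R (x i, y i)) -> R (op x, op y)].

Identity Coercion fun_of_set : set >-> Funclass.

Record con (S : signature) (A : algebra S) := Con {
  con_set :> set (A * A);
  con_congruence : is_congruence con_set }.

HB.instance Definition _ (S : signature) (A : algebra S) :=
  gen_eqMixin (con A).
HB.instance Definition _ (S : signature) (A : algebra S) :=
  gen_choiceMixin (con A).

Section Congruences.
Variables (S : signature) (A : algebra S).
Implicit Types (R X : set (A * A)) (a b c : con A).

Lemma con_inj a b : (a : set (A * A)) = b -> a = b.
Proof.
case: a b => [R hR] [T hT] /= RT; case: _ / RT hT => hT.
by congr Con; exact: Prop_irrelevance.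
Qed.

Lemma con_anti a b : a `<=` b -> b `<=` a -> a = b.
Proof. by move=> ab ba; apply: con_inj; apply/seteqP; split. Qed.

Lemma con_refl a x : a (x, x). Proof. by case: (con_congruence a). Qed.

Lemma con_sym a x y : a (x, y) -> a (y, x).
Proof. by case: (con_congruence a) => _ h _ _; exact: h. Qed.

Lemma con_trans a y x z : a (x, y) -> a (y, z) -> a (x, z).
Proof. by case: (con_congruence a) => _ _ h _; exact: h. Qed.

Lemma con_op a (s : op_symb S) (x y : 'I_(arity s) -> A) :
  (forall i, a (x i, y i)) -> a (op x, op y).
Proof. by case: (con_congruence a) => _ _ _; apply. Qed.

Lemma bigcap_congruence I (P : set I) (F : I -> set (A * A)) :
  (forall i, P i -> is_congruence (F i)) -> is_congruence (\bigcap_(i in P) F i).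
Proof.
move=> h; split.
- by move=> x i /h[].
- by move=> x y xy i Pi; case: (h i Pi) => _ + _ _; apply; exact: xy.
- move=> y x z xy yz i Pi; case: (h i Pi) => _ _ + _; apply; last exact: yz.
  exact: xy.
- by move=> s x y xy i Pi; case: (h i Pi) => _ _ _; apply=> j; exact: xy.
Qed.

Lemma smallest_congruence X : is_congruence (smallest (@is_congruence S A) X).
Proof. by apply: bigcap_congruence => R []. Qed.

Definition con_gen X : con A := Con (smallest_congruence X).

Lemma con_gen_le X a : (con_gen X `<=` a) <-> (X `<=` a).
Proof.
split; first by apply: subset_trans; exact: sub_gen_smallest.
by apply: smallest_sub; exact: con_congruence.
Qed.

Lemma con_gen_sub X : X `<=` con_gen X.
Proof. exact: sub_gen_smallest. Qed.

Lemma diag_congruence : is_congruence [set p : A * A | p.1 = p.2].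
Proof.
split=> //= [y x z -> //|s x y xy].
by congr op; apply/funext => i; exact: xy.
Qed.

Definition con_bot : con A := Con diag_congruence.

Lemma full_congruence : is_congruence [set: A * A].
Proof. by []. Qed.

Definition con_top : con A := Con full_congruence.

Lemma setI_congruence a b : is_congruence (a `&` b).
Proof.
split.
- by move=> x; split; exact: con_refl.
- by move=> x y [? ?]; split; exact: con_sym.
- by move=> y x z [? ?] [? ?]; split; apply: con_trans; eassumption.
- by move=> s x y xy; split; apply: con_op => i; case: (xy i).
Qed.

Definition con_meet a b : con A := Con (setI_congruence a b).

Definition con_inf (P : set (con A)) : con A :=
  Con (bigcap_congruence (fun a (_ : P a) => con_congruence a)).

Definition con_join a b : con A := con_gen (a `|` b).

Definition con_sup (P : set (con A)) : con A :=
  con_gen (\bigcup_(a in P) (a : set (A * A))).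

Definition compact_con a :=
  forall P : set (con A), a `<=` con_sup P ->
  exists F : set (con A), [/\ F `<=` P, finite_set F & a `<=` con_sup F].

Definition fg_con a := exists2 X : set (A * A), finite_set X & a = con_gen X.

Lemma con_bot_le a : con_bot `<=` a.
Proof. by case=> x y /= ->; exact: con_refl. Qed.

Lemma con_sup_le (P : set (con A)) b :
  (con_sup P `<=` b) <-> (forall a, P a -> a `<=` b).
Proof.
rewrite /con_sup con_gen_le; split=> [h a Pa p ap|h p [a Pa ap]].
  by apply: h; exists a.
exact: (h a).
Qed.

Lemma con_sup_ub (P : set (con A)) a : P a -> a `<=` con_sup P.
Proof. by move: a; apply/con_sup_le. Qed.

Lemma con_sup_mono (P Q : set (con A)) : P `<=` Q -> con_sup P `<=` con_sup Q.
Proof. by move=> PQ; apply/con_sup_le => a /PQ; exact: con_sup_ub. Qed.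

Lemma con_join_le a b c : (con_join a b `<=` c) <-> (a `<=` c /\ b `<=` c).
Proof. by rewrite /con_join con_gen_le subUset. Qed.

Lemma finite_sup_congruence (P : set (con A)) :
  is_congruence [set p | exists F : set (con A),
    [/\ F `<=` P, finite_set F & con_sup F p]].
Proof.
split.
- by move=> x; exists set0; split=> //; exact: con_refl.
- by move=> x y [F [? ? ?]]; exists F; split=> //; exact: con_sym.
- move=> y x z [F [FP fF xy]] [G [GP fG yz]]; exists (F `|` G); split.
  + by rewrite subUset.
  + by rewrite finite_setU.
  + apply: (@con_trans _ y).
      by apply: con_sup_mono xy; exact: subsetUl.
    by apply: con_sup_mono yz; exact: subsetUr.
- move=> s x y /choice[F hF]; exists (\bigcup_i F i); split.
  + by apply: bigcup_sub => i _; case: (hF i).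
  + by apply: bigcup_finite => // i _; case: (hF i).
  + apply: con_op => i; case: (hF i) => _ _; apply: con_sup_mono.
    exact: bigcup_sup.
Qed.

Lemma compact_fg a : compact_con a <-> fg_con a.
Proof.
split=> [ca|[X fX ->] P XP].
  have [|F [FP fF aF]] := ca [set c | exists2 p, a p & c = con_gen [set p]].
    move=> p ap; apply: (@con_sup_ub _ (con_gen [set p])); first by exists p.
    exact: con_gen_sub.
  have /choice[h hP] : forall c, exists p, F c -> a p /\ c = con_gen [set p].
    move=> c; have [Fc|nFc] := pselect (F c).
      by have [p ap ->] := FP _ Fc; exists p.
    by case: (carrier_inhabited A) => x; exists (x, x).
  exists (h @` F); first exact: finite_image.
  apply: con_anti.
    apply: subset_trans aF _; apply/con_sup_le => c Fc.
    have [_ ->] := hP _ Fc; apply/con_gen_le => _ ->.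
    by apply: con_gen_sub; exists c.
  by apply/con_gen_le => _ [c Fc <-]; case: (hP _ Fc).
have /choice[F hF] : forall p, exists F : set (con A),
    X p -> [/\ F `<=` P, finite_set F & con_sup F p].
  move=> p; have [Xp|nXp] := pselect (X p); last by exists set0.
  have : con_sup P p by apply: XP; exact: con_gen_sub.
  have : con_sup P `<=` Con (finite_sup_congruence P).
    apply/con_sup_le => c Pc q cq; exists [set c]; split=> //.
      by move=> _ ->.
    by apply: con_sup_ub cq.
  by move=> h /h[F hF]; exists F.
exists (\bigcup_(p in X) F p); split.
- by apply: bigcup_sub => p /hF[].
- by apply: bigcup_finite => // p /hF[].
- apply/con_gen_le => p Xp; have [_ _] := hF p Xp.
  by apply: con_sup_mono; exact: bigcup_sup.
Qed.

Lemma compact_con_bot : compact_con con_bot.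
Proof. by move=> P _; exists set0; split=> //; exact: con_bot_le. Qed.

Lemma compact_con_join a b :
  compact_con a -> compact_con b -> compact_con (con_join a b).
Proof.
move=> ca cb P /con_join_le[/ca[F [FP fF aF]] /cb[G [GP fG bG]]].
exists (F `|` G); split; [by rewrite subUset | by rewrite finite_setU |].
apply/con_join_le; split.
  by apply: subset_trans aF _; apply: con_sup_mono; exact: subsetUl.
by apply: subset_trans bG _; apply: con_sup_mono; exact: subsetUr.
Qed.

End Congruences.

Arguments con_bot {S A}.
Arguments con_top {S A}.

Section ConMorphisms.
Variables (S : signature) (A B : algebra S) (f : hom A B).

Definition pair_map (p : A * A) : B * B := (f p.1, f p.2).

Lemma con_preim_congruence (b : con B) : is_congruence (pair_map @^-1` b).
Proof.
split=> /=.
- by move=> x; exact: con_refl.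
- by move=> x y; exact: con_sym.
- by move=> y x z; exact: con_trans.
- by move=> s x y xy; rewrite /pair_map/= !hom_op; apply: con_op => i; exact: xy.
Qed.

Definition con_preim (b : con B) : con A := Con (con_preim_congruence b).

Definition con_ker : con A := con_preim con_bot.

(* f^bullet(a) *)
Definition con_push (a : con A) : con B := con_gen (pair_map @` a).

Lemma con_push_le (a : con A) (b : con B) :
  (con_push a `<=` b) <-> (a `<=` con_preim b).
Proof.
rewrite /con_push con_gen_le; split=> [h p ap|h _ [p ap <-]]; last exact: h.
by apply: h; exists p.
Qed.

Lemma compact_con_push (a : con A) : compact_con a -> compact_con (con_push a).
Proof.
move=> /compact_fg[X fX ->]; apply/compact_fg.
exists (pair_map @` X); first exact: finite_image.
apply: con_anti; last first.
  apply/con_gen_le => _ [p Xp <-]; apply: con_gen_sub.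
  by exists p => //; exact: con_gen_sub.
apply/con_push_le/con_gen_le => p Xp; apply: con_gen_sub.
by exists p.
Qed.

Hypothesis fs : surjective_hom f.

Lemma con_image_congruence (a : con A) :
  is_congruence (pair_map @` con_join a con_ker).
Proof.
set t := con_join _ _.
have kt : con_ker `<=` t by case/con_join_le: (@subset_refl _ t).
split.
- by move=> y; have [x <-] := fs y; exists (x, x) => //; exact: con_refl.
- by move=> _ _ [[x y] xy [<- <-]]; exists (y, x) => //; exact: con_sym.
- move=> _ _ _ [[x y] xy [<- <-]] [[y' z] yz [yy' <-]].
  exists (x, z) => //; apply: (con_trans xy); apply: con_trans yz.
  by apply: kt; rewrite /= /pair_map/= yy'.
- move=> s x y xy.
  have /choice[p pP] : forall i, exists p, t p /\ pair_map p = (x i, y i).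
    by move=> i; have [p tp e] := xy i; exists p.
  exists (op (fun i => (p i).1), op (fun i => (p i).2)).
    by apply: con_op => i; case: (pP i) => + _; case: (p i).
  rewrite /pair_map/= !hom_op; congr pair; congr op; apply/funext => i;
    by case: (pP i) => _ [].
Qed.

(* f(a \/ Ker f), which for surjective f is a congruence of B *)
Definition con_image (a : con A) : con B := Con (con_image_congruence a).

End ConMorphisms.

Definition congruence_modular (S : signature) (V : variety S) :=
  forall (A : algebra_in V) (a b c : con A), a `<=` c ->
    con_join a (con_meet b c) = con_meet (con_join a b) c.

Definition subuniverse (S : signature) (A : algebra S) (X : set A) :=
  forall (s : op_symb S) (x : 'I_(arity s) -> A),
    (forall i, X (x i)) -> X (op x).

Definition nontrivial_alg (S : signature) (A : algebra S) :=
  exists x y : A, x <> y.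

Definition semidegenerate (S : signature) (V : variety S) :=
  forall A : algebra_in V, nontrivial_alg A ->
    ~ exists x : A, subuniverse [set x].

Section TopCompact.
Variables (S : signature) (V : variety S) (A : algebra_in V) (t : con A).

Let cls (x : A) : set A := [set y | t (x, y)].
Let qcar := {X : set A | exists x, X = cls x}.
Let proj (x : A) : qcar := exist _ (cls x) (ex_intro _ x erefl).
Let rep (X : qcar) : A := sval (cid (svalP X)).

Let qcar_inj (X Y : qcar) : sval X = sval Y -> X = Y.
Proof.
case: X Y => [X hX] [Y hY] /= XY; case: _ / XY hY => hY.
by congr exist; exact: Prop_irrelevance.
Qed.

Let projP x y : (proj x = proj y) <-> t (x, y).
Proof.
split=> [[e]|xy].
  by have : cls y y by [exact: con_refl]; rewrite -e.
apply: qcar_inj; apply/seteqP; split=> z /=; rewrite /cls /= => h.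
  by apply: con_trans h; exact: con_sym.
exact: con_trans h.
Qed.

Let repK X : proj (rep X) = X.
Proof.
apply: qcar_inj; rewrite /rep /=; case: (cid _) => x /= e.
by case: X e.
Qed.

Let quo_alg : algebra S :=
  @Algebra S qcar (fun s x => proj (op (fun i => rep (x i))))
    (let: inhabits x := carrier_inhabited A in inhabits (proj x)).

Let quo_eval (v : nat -> quo_alg) e :
  eval v e = proj (eval (fun n => rep (v n)) e).
Proof.
elim: e => [n|s ts IH] /=; first by rewrite repK.
apply/projP/con_op => i; apply/projP.
by rewrite repK IH.
Qed.

Lemma quo_models : models quo_alg V.
Proof. by move=> e Ve v; rewrite !quo_eval (alg_models Ve). Qed.

Lemma top_of_idempotent (x0 : A) : semidegenerate V ->
  (forall s : op_symb S, t (@op S A s (fun=> x0), x0)) -> t = con_top.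
Proof.
move=> Vsd hx; apply: con_anti => // -[x y] _; apply: contrapT => nxy.
apply: (Vsd (AlgebraIn quo_models)).
  by exists (proj x), (proj y) => /projP.
exists (proj x0) => s z hz /=; apply/projP.
apply: con_trans (hx s); apply: con_op => i; apply/projP.
by rewrite repK; exact: hz.
Qed.

End TopCompact.

Lemma compact_con_top (S : signature) (V : variety S) (A : algebra_in V) :
  semidegenerate V -> compact_con (@con_top S A).
Proof.
move=> Vsd; case: (carrier_inhabited A) => x0; apply/compact_fg.
exists (range (fun s : op_symb S => (@op S A s (fun=> x0), x0))).
  exact/finite_image/finite_finset.
symmetry; apply: (@top_of_idempotent S V A _ x0 Vsd) => s.
by apply: con_gen_sub; exists s.
Qed.

Section Commutator.
Variables (S : signature) (V : variety S).

Definition con_operation := forall A : algebra_in V, con A -> con A -> con A.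

Definition commutator_conditions (C : con_operation) :=
  forall (A B : algebra_in V) (f : hom A B) (fs : surjective_hom f)
    (a b : con A),
    C A a b `<=` a `&` b /\
    con_join (C A a b) (con_ker f) =
      con_preim f (C B (con_image fs a) (con_image fs b)).

(* The pointwise supremum of all the operations satisfying the defining
   conditions; it satisfies them too (commutator_cond), hence it is the greatest
   one (commutator_max). *)
Definition commutator (A : algebra_in V) (a b : con A) : con A :=
  con_sup [set c | exists2 C : con_operation,
    commutator_conditions C & c = C A a b].

Lemma commutator_max (C : con_operation) : commutator_conditions C ->
  forall (A : algebra_in V) (a b : con A), C A a b `<=` commutator a b.
Proof. by move=> hC A a b; apply: con_sup_ub; exists C. Qed.

Lemma commutator_cond : commutator_conditions commutator.
Proof.
move=> A B f fs a b; split.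
  apply: (@subset_trans _ (con_meet a b)) => //.
  by apply/con_sup_le => _ [C hC ->]; case: (hC A B f fs a b).
set t := con_join _ _.
have [ct kt] : commutator a b `<=` t /\ con_ker f `<=` t.
  by apply/con_join_le; exact: subset_refl.
apply: con_anti.
  apply/con_join_le; split; last by move=> p e; exact: (@con_bot_le S B _ (pair_map f p) e).
  apply/con_sup_le => _ [C hC ->]; have [_ e] := hC A B f fs a b.
  apply: (@subset_trans _ (con_join (C A a b) (con_ker f))).
    by have /con_join_le[] := @subset_refl _ (con_join (C A a b) (con_ker f)).
  by rewrite e => p; exact: (commutator_max hC).
have ht : commutator (con_image fs a) (con_image fs b) `<=` con_image fs t.
  apply/con_sup_le => _ [C hC ->]; have [_ e] := hC A B f fs a b.
  move=> [y1 y2] h; have [x1 e1] := fs y1; have [x2 e2] := fs y2.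
  exists (x1, x2); last by rewrite /pair_map /= e1 e2.
  have /con_join_le[+ _] := @subset_refl _ (con_join t (con_ker f)); apply.
  have : con_join (C A a b) (con_ker f) `<=` t.
    apply/con_join_le; split=> //; apply: subset_trans ct.
    exact: commutator_max.
  by apply; rewrite e /= /pair_map /= e1 e2.
have tk : con_join t (con_ker f) `<=` t.
  by apply/con_join_le; split.
move=> [x1 x2] /ht[[z1 z2] /tk z12 [e1 e2]].
apply: (@con_trans _ _ _ z1); first by apply: kt; rewrite /= /pair_map /= e1.
by apply: (con_trans z12); apply: kt; rewrite /= /pair_map /= e2.
Qed.

End Commutator.

Section Spectrum.
Variables (S : signature) (V : variety S) (A : algebra_in V).
Implicit Types (a b c p : con A).

(* a^perp *)
Definition con_perp a : con A :=
  con_sup [set c | commutator a c = con_bot].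

Definition prime_con p :=
  p <> con_top /\
  forall a b, commutator a b `<=` p -> a `<=` p \/ b `<=` p.

Definition radical a : con A := con_inf [set p | prime_con p /\ a `<=` p].

Definition semiprime := radical con_bot = con_bot.

Definition compact_comm_closed :=
  forall a b, compact_con a -> compact_con b -> compact_con (commutator a b).

Definition kcon := {a : con A | `[< compact_con a >]}.
HB.instance Definition _ := Choice.on kcon.

Definition kcon_of a (ca : compact_con a) : kcon := exist _ a (asboolT ca).

Lemma kcon_compact (a : kcon) : compact_con (val a).
Proof. exact/asboolP/(valP a). Qed.

Definition radical_equiv (a b : kcon) : bool :=
  radical (val a) == radical (val b).

Lemma radical_equiv_refl : reflexive radical_equiv.
Proof. by move=> a; exact: eqxx. Qed.

Lemma radical_equiv_sym : symmetric radical_equiv.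
Proof. by move=> a b; exact: eq_sym. Qed.

Lemma radical_equiv_trans : transitive radical_equiv.
Proof. by move=> b a c /eqP ab /eqP bc; apply/eqP; rewrite ab. Qed.

Canonical radical_equiv_rel := EquivRel radical_equiv
  radical_equiv_refl radical_equiv_sym radical_equiv_trans.

Definition prime_hull a : set (con A) := [set p | prime_con p /\ a `<=` p].

Lemma radical_le a p : prime_con p -> (radical a `<=` p) <-> (a `<=` p).
Proof.
move=> pp; split=> h.
  by apply: subset_trans h => q aq c [_]; apply.
by move=> q; apply.
Qed.

Lemma radical_eqP a b : (radical a = radical b) <-> (prime_hull a = prime_hull b).
Proof.
split=> h; last by rewrite /radical -!/(prime_hull _) h.
apply/seteqP; split=> p [pp le]; split=> //; apply/(radical_le _ pp).
  by rewrite -h; apply/radical_le.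
by rewrite h; apply/radical_le.
Qed.

Lemma prime_hull_commutator a b :
  prime_hull (commutator a b) = prime_hull a `|` prime_hull b.
Proof.
apply/seteqP; split=> p.
  by case=> pp h; case: (pp.2 _ _ h); [left|right].
have id_surj : surjective_hom (@Hom S A A id (fun _ _ => erefl)).
  by move=> x; exists x.
have [h _] := @commutator_cond S V A A _ id_surj a b.
by case=> -[pp le]; split=> //; apply: (subset_trans h) => q [? ?]; exact: le.
Qed.

Lemma prime_hull_join a b :
  prime_hull (con_join a b) = prime_hull a `&` prime_hull b.
Proof.
apply/seteqP; split=> p; first by case=> pp /con_join_le[].
by case=> -[pp ?] [_ ?]; split=> //; apply/con_join_le.
Qed.

Lemma prime_hull_bot : prime_hull con_bot = [set p | prime_con p].
Proof. by apply/seteqP; split=> p; [case|split=> //; exact: con_bot_le]. Qed.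

Lemma prime_hull_top : prime_hull con_top = set0.
Proof. by rewrite -subset0 => p [[npt _] tp]; apply: npt; exact: con_anti. Qed.

(* The two hypotheses are not used by the quotient itself but by its lattice
   structure: the top element and the meets. *)
Definition reticulation
  of semidegenerate V & compact_comm_closed := {eq_quot radical_equiv_rel}.

End Spectrum.

Arguments kcon_of {S V A} a ca.
Arguments kcon_compact {S V A} a.

Section Reticulation.
Variables (S : signature) (V : variety S) (Vsd : semidegenerate V).
Variables (A : algebra_in V) (AK : compact_comm_closed A).

Local Notation L := (reticulation Vsd AK).

HB.instance Definition _ := Choice.on L.

Definition lambda (a : kcon A) : L := \pi_{eq_quot radical_equiv_rel A} a.

Lemma lambda_eqP (a b : kcon A) :
  lambda a = lambda b <-> radical (val a) = radical (val b).
Proof.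
split=> [/eqmodP /eqP //|h].
by apply/eqmodP/eqP.
Qed.

Let rp (x : L) : kcon A := repr (x : {eq_quot radical_equiv_rel A}).

Let rpK x : lambda (rp x) = x. Proof. exact: reprK. Qed.

Let hull (x : L) := prime_hull (val (rp x)).

Let hull_lambda a : hull (lambda a) = prime_hull (val a).
Proof. by apply/radical_eqP/lambda_eqP; rewrite rpK. Qed.

Let hull_inj x y : hull x = hull y -> x = y.
Proof. by move=> h; rewrite -(rpK x) -(rpK y); apply/lambda_eqP/radical_eqP. Qed.

Definition kcomm (a b : kcon A) : kcon A :=
  kcon_of _ (AK (kcon_compact a) (kcon_compact b)).

Definition kjoin (a b : kcon A) : kcon A :=
  kcon_of _ (compact_con_join (kcon_compact a) (kcon_compact b)).

Definition kbot : kcon A := kcon_of con_bot (@compact_con_bot S A).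

Definition ktop : kcon A := kcon_of con_top (@compact_con_top S V A Vsd).

Definition ret_meet (x y : L) : L := lambda (kcomm (rp x) (rp y)).
Definition ret_join (x y : L) : L := lambda (kjoin (rp x) (rp y)).

Let hull_meet x y : hull (ret_meet x y) = hull x `|` hull y.
Proof. by rewrite hull_lambda prime_hull_commutator. Qed.

Let hull_join x y : hull (ret_join x y) = hull x `&` hull y.
Proof. by rewrite hull_lambda prime_hull_join. Qed.

Let hullE := (hull_meet, hull_join).

Fact ret_meetC : commutative ret_meet.
Proof. by move=> x y; apply: hull_inj; rewrite !hullE setUC. Qed.
Fact ret_joinC : commutative ret_join.
Proof. by move=> x y; apply: hull_inj; rewrite !hullE setIC. Qed.
Fact ret_meetA : associative ret_meet.
Proof. by move=> x y z; apply: hull_inj; rewrite !hullE setUA. Qed.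
Fact ret_joinA : associative ret_join.
Proof. by move=> x y z; apply: hull_inj; rewrite !hullE setIA. Qed.
Fact ret_joinKI (y x : L) : ret_meet x (ret_join x y) = x.
Proof.
by apply: hull_inj; rewrite !hullE; apply/setUidPl; exact: subIsetl.
Qed.
Fact ret_meetKU (y x : L) : ret_join x (ret_meet x y) = x.
Proof.
by apply: hull_inj; rewrite !hullE; apply/setIidPl; exact: subsetUl.
Qed.
Fact ret_meetUl : left_distributive ret_meet ret_join.
Proof. by move=> x y z; apply: hull_inj; rewrite !hullE setUIl. Qed.
Fact ret_meetxx : idempotent_op ret_meet.
Proof. by move=> x; apply: hull_inj; rewrite !hullE setUid. Qed.

Fact ret_display : Order.disp_t. Proof. exact: Order.Disp tt tt. Qed.

HB.instance Definition _ :=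
  @Order.isMeetJoinDistrLattice.Build ret_display L
    (fun x y => ret_meet x y == x)
    (fun x y => (y != x) && (ret_meet x y == x))
    ret_meet ret_join (fun _ _ => erefl) (fun _ _ => erefl)
    ret_meetC ret_joinC ret_meetA ret_joinA ret_joinKI ret_meetKU
    ret_meetUl ret_meetxx.

Fact ret_le0x (x : L) : (lambda kbot <= x)%O.
Proof.
apply/eqP/hull_inj; rewrite hullE hull_lambda prime_hull_bot.
by apply/setUidPl => p [].
Qed.

Fact ret_lex1 (x : L) : (x <= lambda ktop)%O.
Proof.
by apply/eqP/hull_inj; rewrite hullE hull_lambda prime_hull_top setU0.
Qed.

HB.instance Definition _ := @Order.hasBottom.Build ret_display L _ ret_le0x.
HB.instance Definition _ := @Order.hasTop.Build ret_display L _ ret_lex1.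

Lemma lambda_surj (x : L) : exists a, x = lambda a.
Proof. by exists (rp x); rewrite rpK. Qed.

Lemma lambda_meet (a b : kcon A) :
  (lambda a `&` lambda b)%O = lambda (kcomm a b).
Proof.
by apply: hull_inj; rewrite hullE !hull_lambda prime_hull_commutator.
Qed.

Lemma lambda_join (a b : kcon A) :
  (lambda a `|` lambda b)%O = lambda (kjoin a b).
Proof. by apply: hull_inj; rewrite hullE !hull_lambda prime_hull_join. Qed.

Lemma lambda_bot : lambda kbot = \bot%O. Proof. by []. Qed.

Lemma lambda_top : lambda ktop = \top%O. Proof. by []. Qed.

End Reticulation.

(* The library's {tblmorphism _ -> _} only preserves \bot and \top. *)
#[short(type="tbdlmorphism")]
HB.structure Definition TBDLMorphism d (L : tbDistrLatticeType d)
    d' (L' : tbDistrLatticeType d') :=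
  {g of @Order.LatticeMorphism d L d' L' g
      & @Order.TBLatticeMorphism d L d' L' g}.

Definition Ann d (L : tbDistrLatticeType d) (x : L) : set L :=
  [set y | (x `&` y)%O = \bot%O].

Definition Stone_morphism d (L : tbDistrLatticeType d)
    d' (L' : tbDistrLatticeType d') (g : tbdlmorphism L L') :=
  forall x y : L, Ann x = Ann y -> Ann (g x) = Ann (g y).

Section Morphisms.
Variables (S : signature) (V : variety S) (A B : algebra_in V) (f : hom A B).

Definition admissible :=
  forall p : con B, prime_con p -> prime_con (con_preim f p).

Definition PP_morphism :=
  forall a b : con A, compact_con a -> compact_con b ->
    con_perp a = con_perp b -> con_perp (con_push f a) = con_perp (con_push f b).

Definition kpush (a : kcon A) : kcon B :=
  kcon_of _ (@compact_con_push S A B f (val a) (kcon_compact a)).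

End Morphisms.

Section ReticulationMap.
Variables (S : signature) (V : variety S) (Vsd : semidegenerate V).
Variables (A B : algebra_in V).
Variables (AK : compact_comm_closed A) (BK : compact_comm_closed B).
Variables (f : hom A B) (fadm : admissible f).

Local Notation LA := (reticulation Vsd AK).
Local Notation LB := (reticulation Vsd BK).

Definition ret_fun of admissible f := fun x : LA =>
  lambda Vsd BK (kpush f (repr (x : {eq_quot radical_equiv_rel A}))).

Let prime_hull_push (a : con A) (p : con B) :
  prime_hull (con_push f a) p <->
  prime_con p /\ prime_hull a (con_preim f p).
Proof.
split=> [[pp /con_push_le h]|[pp [_ /con_push_le h]]] //.
by split=> //; split=> //; exact: fadm.
Qed.

Lemma ret_fun_lambda (a : kcon A) :
  ret_fun fadm (lambda Vsd AK a) = lambda Vsd BK (kpush f a).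
Proof.
apply/lambda_eqP/radical_eqP => /=.
have /lambda_eqP/radical_eqP h : lambda Vsd AK (repr (lambda Vsd AK a
    : {eq_quot radical_equiv_rel A})) = lambda Vsd AK a by exact: reprK.
by apply/seteqP; split=> p /prime_hull_push h2; apply/prime_hull_push;
  rewrite ?h // -h.
Qed.

Fact ret_fun_meet : Order.meet_morphism (ret_fun fadm).
Proof.
move=> x y; have [a ->] := lambda_surj x; have [b ->] := lambda_surj y.
rewrite lambda_meet !ret_fun_lambda lambda_meet.
apply/lambda_eqP/radical_eqP => /=; rewrite prime_hull_commutator.
apply/seteqP; split=> p.
  move=> /prime_hull_push[pp]; rewrite prime_hull_commutator.
  by case=> h; [left|right]; apply/prime_hull_push.
case=> /prime_hull_push[pp h]; apply/prime_hull_push;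
  by rewrite prime_hull_commutator; split=> //; [left + right].
Qed.

Fact ret_fun_join : Order.join_morphism (ret_fun fadm).
Proof.
move=> x y; have [a ->] := lambda_surj x; have [b ->] := lambda_surj y.
rewrite lambda_join !ret_fun_lambda lambda_join.
apply/lambda_eqP/radical_eqP => /=; rewrite prime_hull_join.
apply/seteqP; split=> p.
  move=> /prime_hull_push[pp]; rewrite prime_hull_join.
  by case=> ha hb; split; apply/prime_hull_push.
case=> /prime_hull_push[pp ha] /prime_hull_push[_ hb]; apply/prime_hull_push.
by rewrite prime_hull_join.
Qed.

Fact ret_fun_le : {homo ret_fun fadm : x y / (x <= y)%O}.
Proof. by move=> x y /meet_idPl xy; apply/meet_idPl; rewrite -ret_fun_meet xy. Qed.

Fact ret_fun_bot : ret_fun fadm \bot%O = \bot%O.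
Proof.
rewrite -!lambda_bot ret_fun_lambda; apply/lambda_eqP/radical_eqP => /=.
rewrite prime_hull_bot; apply/seteqP; split=> p; first by case.
move=> pp; apply/prime_hull_push; rewrite prime_hull_bot; split=> //.
exact: fadm.
Qed.

Fact ret_fun_top : ret_fun fadm \top%O = \top%O.
Proof.
rewrite -!lambda_top ret_fun_lambda; apply/lambda_eqP/radical_eqP => /=.
rewrite prime_hull_top -subset0 => p /prime_hull_push.
by rewrite prime_hull_top => -[].
Qed.

HB.instance Definition _ := Order.isOrderMorphism.Build _ LA _ LB
  (ret_fun fadm) ret_fun_le.
HB.instance Definition _ := Order.isMeetLatticeMorphism.Build _ LA _ LB
  (ret_fun fadm) ret_fun_meet.
HB.instance Definition _ := Order.isJoinLatticeMorphism.Build _ LA _ LB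
  (ret_fun fadm) ret_fun_join.
HB.instance Definition _ := Order.isBLatticeMorphism.Build _ LA _ LB
  (ret_fun fadm) ret_fun_bot.
HB.instance Definition _ := Order.isTLatticeMorphism.Build _ LA _ LB
  (ret_fun fadm) ret_fun_top.

Definition reticulation_map : tbdlmorphism LA LB := ret_fun fadm.

Lemma reticulation_mapE (a : kcon A) :
  reticulation_map (lambda Vsd AK a) = lambda Vsd BK (kpush f a).
Proof. exact: ret_fun_lambda. Qed.

Lemma reticulation_map_unique (g : LA -> LB) :
  (forall a : kcon A, g (lambda Vsd AK a) = lambda Vsd BK (kpush f a)) ->
  g =1 reticulation_map.
Proof.
by move=> h x; have [a ->] := lambda_surj x; rewrite h reticulation_mapE.
Qed.

End ReticulationMap.

(* Main.v *)
From mathcomp Require Import all_boot all_order.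
From mathcomp Require Import boolp classical_sets cardinality.
Require Import Defs.

(** In a semiprime algebra the equation [a, c] = bot only depends on primes: it
    says that every prime congruence contains a or contains c
    ([commutator_eq_bot]). Since containing all members of a family amounts to
    containing their supremum, perp(a) itself annihilates a, so that the
    compact congruences below perp(a) are exactly those with [a, c] = bot
    ([le_con_perp]). As the reticulation turns commutators into meets, their
    images under lambda are exactly the annihilator of lambda(a) ([Ann_lambda]).

    A congruence is determined by the compact congruences below it, and every
    element of L(A) is some lambda(c); hence perp(a) = perp(b) if and only if
    Ann(lambda(a)) = Ann(lambda(b)) ([con_perp_eq_Ann]). Applying this in A to
    the hypotheses and in B to the conclusions identifies the PP condition on f
    with the Stone condition on L(f), because L(f) sends lambda(a) to
    lambda(f^bullet(a)). *)

Set Implicit Arguments.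
Unset Strict Implicit.
Unset Printing Implicit Defensive.

Local Open Scope classical_set_scope.

(** Congruence lattices are algebraic: a congruence is the union of the
    principal congruences below it. *)
Lemma con_eq_compact (S : signature) (A : algebra S) (a b : con A) :
  (forall c, compact_con c -> c `<=` a <-> c `<=` b) -> a = b.
Proof.
move=> h.
have prin q : compact_con (con_gen [set q] : con A).
  by apply/compact_fg; exists [set q]; first exact: finite_set1.
have genP q (d : con A) : con_gen [set q] `<=` d <-> d q.
  by rewrite con_gen_le sub1set inE.
by apply: con_anti => q /genP/(h _ (prin q))/genP.
Qed.

Section Perp.
Variables (S : signature) (V : variety S) (A : algebra_in V).
Hypothesis Asp : semiprime A.
Implicit Types a b c : con A.

(** Semiprimeness says that a congruence below all primes is bot, and a prime
    contains [a, b] only if it contains a or b. *)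
Lemma commutator_eq_bot a b :
  commutator a b = con_bot <->
  (forall p, prime_con p -> a `<=` p \/ b `<=` p).
Proof.
split=> [ab0 p pp|h]; first by apply: pp.2; rewrite ab0; exact: con_bot_le.
apply: con_anti; last exact: con_bot_le.
rewrite -Asp => q abq p [pp _]; move: q abq.
suff [] : prime_hull (commutator a b) p by [].
by rewrite prime_hull_commutator; case: (h p pp) => ?; [left|right].
Qed.

(** For the inclusion from left to right, a prime that misses a contains every
    c with [a, c] = bot, hence contains their supremum. *)
Lemma le_con_perp a c : c `<=` con_perp a <-> commutator a c = con_bot.
Proof.
split=> [cp|ac0]; last exact: con_sup_ub.
apply/commutator_eq_bot => p pp; have [ap|nap] := pselect (a `<=` p).
  by left.
right; apply: subset_trans cp _; apply/con_sup_le => d.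
by move=> /commutator_eq_bot/(_ p pp)[].
Qed.

Variables (Vsd : semidegenerate V) (AK : compact_comm_closed A).

(** Under semiprimeness the class of bot in the reticulation consists of bot
    alone, so a meet of classes vanishes only if the commutator of their
    representatives does. *)
Lemma Ann_lambda (x y : kcon A) :
  Ann (lambda Vsd AK x) (lambda Vsd AK y) <-> val y `<=` con_perp (val x).
Proof.
rewrite le_con_perp /Ann /= lambda_meet -lambda_bot lambda_eqP /=.
split=> [e|-> //]; apply/commutator_eq_bot => p pp; apply: pp.2.
apply/(radical_le _ pp); rewrite e; apply/(radical_le _ pp).
exact: con_bot_le.
Qed.

Lemma con_perp_eq_Ann (x y : kcon A) :
  con_perp (val x) = con_perp (val y) <->
  Ann (lambda Vsd AK x) = Ann (lambda Vsd AK y).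
Proof.
split=> [e|e].
  by apply/seteqP; split=> z; have [c ->] := lambda_surj z;
    rewrite !Ann_lambda e.
apply: con_eq_compact => c cc.
by rewrite -!(Ann_lambda _ (kcon_of c cc)) e.
Qed.

End Perp.

Theorem theorem11p7 (S : signature) (V : variety S)
  (Vmod : congruence_modular V) (Vsd : semidegenerate V)
  (A B : algebra_in V) (Asp : semiprime A) (Bsp : semiprime B)
  (AK : compact_comm_closed A) (BK : compact_comm_closed B)
  (f : hom A B) (fadm : admissible f) :
  PP_morphism f <-> Stone_morphism (reticulation_map Vsd AK BK fadm).
Proof.
split=> [PP x y|St a b ca cb ab].
  have [a ->] := lambda_surj x; have [b ->] := lambda_surj y.
  rewrite !reticulation_mapE => /(con_perp_eq_Ann Asp) ab.
  apply/(con_perp_eq_Ann Bsp) => /=.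
  by apply: PP => //; exact: kcon_compact.
apply/(con_perp_eq_Ann Bsp Vsd BK (kpush f (kcon_of a ca))
         (kpush f (kcon_of b cb))).
rewrite -!(reticulation_mapE Vsd AK BK fadm).
by apply: St; apply/(con_perp_eq_Ann Asp).
Qed.
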